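(* Let $(X,\mathcal{A},\mu)$ be a measure space and let $I$ be an ideal (not necessarily proper) in $\mathcal{M}(X,\mathcal{A})$. If $X\setminus\bigcap Z[I]$ is a $\mu$-bounded subset of $X$, then the $U_\mu^I$-topology and the $m_\mu^I$-topology on $\mathcal{M}(X,\mathcal{A})$ coincide. Moreover, if $I$ is countably generated, then the converse also holds: if the $U_\mu^I$-topology equals the $m_\mu^I$-topology on $\mathcal{M}(X,\mathcal{A})$, then $X\setminus\bigcap Z[I]$ is a $\mu$-bounded subset of $X$.
   Context: $X$ is a non-empty set, $\mathcal{A}$ a $\sigma$-algebra on $X$, $\mu:\mathcal{A}\to[0,\infty]$ a measure. $\mathcal{M}(X,\mathcal{A})$ is the commutative ring of all measurable functions $X\to\mathbb{R}$ under pointwise operations. A $\mu$-null set is a set $E\in\mathcal{A}$ with $\mu(E)=0$. A positive unit of $\mathcal{M}(X,\mathcal{A})$ is a $u\in\mathcal{M}(X,\mathcal{A})$ with $u(x)>0$ for all $x\in X$. For an ideal $I$ of $\mathcal{M}(X,\mathcal{A})$ (not necessarily proper), $f\in\mathcal{M}(X,\mathcal{A})$, real $\epsilon>0$ and a positive unit $u$, put $U_\mu(f,I,\epsilon)=\{g\in\mathcal{M}(X,\mathcal{A}): g-f\in I$ and $\sup_{x\in X\setminus E}|f(x)-g(x)|<\epsilon$ for some $\mu$-null set $E\}$ (supremum taken in $[0,\infty]$) and $m_\mu(f,I,u)=\{g\in\mathcal{M}(X,\mathcal{A}): g-f\in I$ and there is a $\mu$-null set $E$ with $|f(x)-g(x)|<u(x)$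 for all $x\in X\setminus E\}$. The sets $U_\mu(f,I,\epsilon)$ form an open base of the $U_\mu^I$-topology on $\mathcal{M}(X,\mathcal{A})$, and the sets $m_\mu(f,I,u)$ form an open base of the $m_\mu^I$-topology. $Z(f)=\{x\in X: f(x)=0\}$, $Z[I]=\{Z(f): f\in I\}$, and $\bigcap Z[I]=\bigcap_{f\in I}Z(f)$. A subset $Y\subseteq X$ is $\mu$-bounded if for every $f\in\mathcal{M}(X,\mathcal{A})$ there is a $\mu$-null set $E$ such that $f$ is bounded on $Y\setminus E$. *)

(* Defs.v *)
From HB Require Import structures.
From mathcomp Require Import all_boot all_order all_algebra.
From mathcomp Require Import all_classical all_reals all_analysis measurable_realfun.
Import Order.TTheory GRing.Theory Num.Theory.
Import numFieldNormedType.Exports.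

Set Implicit Arguments.
Unset Strict Implicit.
Unset Printing Implicit Defensive.

Local Open Scope classical_set_scope.
Local Open Scope ring_scope.

(* `measurableType` only ranges over nonempty types, as it inherits from
   `pointedType`. *)

(* Ideals need not be proper, unlike those of `ring_quotient.idealr`. *)
Record is_ideal (A : comPzRingType) (I : set A) : Prop := IsIdeal {
  ideal0 : I 0;
  idealD : forall a b, I a -> I b -> I (a + b);
  idealMl : forall a b, I b -> I (a * b)
}.

Definition ideal_generated (A : comPzRingType) (S : set A) : set A :=
  smallest (@is_ideal A) S.

Definition countably_generated (A : comPzRingType) (I : set A) : Prop :=
  exists2 S : set A, countable S & I = ideal_generated S.

Section measurable_function_topologies.
Context d (T : measurableType d) (R : realType).
Local Notation M := {mfun T >-> R}.
Implicit Types (f g : M) (I : set M) (E Y : set T).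

Definition zero_set f : set T := [set x | f x = 0].

Definition zero_sets I : set (set T) := zero_set @` I.

(* The ring of measurable functions, retyped to carry the two topologies. The
   proof [hI] is a parameter because the families [U_base] and [m_base] below
   are only bases when [I] is an ideal. *)
Definition U_space (mu : {measure set T -> \bar R}) I (hI : is_ideal I) : Type :=
  M.
Definition m_space (mu : {measure set T -> \bar R}) I (hI : is_ideal I) : Type :=
  M.

Context (mu : {measure set T -> \bar R}).

Definition null E : Prop := measurable E /\ mu E = 0%E.

Definition mu_bounded Y : Prop :=
  forall f, exists2 E, null E & [bounded f x | x in Y `\` E].

Definition positive_unit (u : M) : Prop := forall x, 0 < u x.

(* In \bar R the supremum of the empty set is -oo; the `maxe 0` gives the
   supremum in [0, +oo]. *)
Definition sup_dist f g E : \bar R :=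
  maxe 0%E (ereal_sup [set `|f x - g x|%:E | x in ~` E]).

Definition U_mu f I (e : R) : set M :=
  [set g : M | I (g - f) /\ exists2 E, null E & (sup_dist f g E < e%:E)%E].

Definition m_mu f I (u : M) : set M :=
  [set g : M | I (g - f) /\
    exists2 E, null E & forall x, ~ E x -> `|f x - g x| < u x].

Definition U_base I : set (set M) :=
  [set B | exists f e, 0 < e /\ B = U_mu f I e].

Definition m_base I : set (set M) :=
  [set B | exists f u, positive_unit u /\ B = m_mu f I u].

Lemma null0 : null set0.
Proof. by split => //; rewrite measure0. Qed.

Lemma nullU E F : null E -> null F -> null (E `|` F).
Proof.
move=> [mE E0] [mF F0]; split; first exact: measurableU.
by rewrite measureU0.
Qed.

Lemma sup_dist_ltP f g E (e : R) : (sup_dist f g E < e%:E)%E <->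
  exists2 c : R, 0 <= c < e & forall x, ~ E x -> `|f x - g x| <= c.
Proof.
split; last first.
  move=> [c /andP[c0 ce] fg]; apply: (@le_lt_trans _ _ c%:E).
    rewrite ge_max lee_fin c0/=; apply: ge_ereal_sup => _ [x Ex <-].
    by rewrite lee_fin; exact: fg.
  by rewrite lte_fin.
move=> lte; have ge0 : (0 <= sup_dist f g E)%E by rewrite le_max lexx.
have fins : sup_dist f g E \is a fin_num.
  by rewrite ge0_fin_numE// (lt_trans lte)// ltry.
exists (fine (sup_dist f g E)).
  by rewrite fine_ge0//= -lte_fin fineK.
move=> x Ex; rewrite -lee_fin fineK// le_max; apply/orP; right.
by apply: ereal_sup_ubound; exists x.
Qed.

Context I (hI : is_ideal I).

Lemma ideal_trans f g h : I (g - f) -> I (h - g) -> I (h - f).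
Proof. by move=> fg gh; rewrite -(subrKA g); exact: idealD. Qed.

Lemma U_mu_refl f (e : R) : 0 < e -> U_mu f I e f.
Proof.
move=> e0; split; first by rewrite subrr; exact: ideal0.
exists set0; first exact: null0.
by apply/sup_dist_ltP; exists 0; [rewrite lexx|move=> x _; rewrite subrr normr0].
Qed.

Lemma U_mu_nested f g (e : R) : U_mu f I e g ->
  exists2 e', 0 < e' & forall e'', e'' <= e' -> U_mu g I e'' `<=` U_mu f I e.
Proof.
move=> [Igf [E nE /sup_dist_ltP[c /andP[c0 ce] fg]]].
exists (e - c); first by rewrite subr_gt0.
move=> e'' le h [Ihg [F nF /sup_dist_ltP[c' /andP[c'0 ce'] gh]]].
split; first exact: ideal_trans Igf Ihg.
exists (E `|` F); first exact: nullU.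
apply/sup_dist_ltP; exists (c + c').
  by rewrite addr_ge0//= -ltrBrDl (lt_le_trans ce').
move=> x /not_orP[Ex Fx]; rewrite (le_trans (ler_distD (g x) _ _))// lerD//.
  exact: fg.
exact: gh.
Qed.

Lemma U_base_cover : \bigcup_(B in U_base I) B = [set: M].
Proof.
apply/seteqP; split => // f _; exists (U_mu f I 1).
  by exists f, 1; rewrite ltr01.
exact: U_mu_refl.
Qed.

Lemma U_base_join (A B : set M) f : U_base I A -> U_base I B -> A f -> B f ->
  exists C, [/\ U_base I C, C f & C `<=` A `&` B].
Proof.
move=> [fA [a [a0 ->]]] [fB [b [b0 ->]]].
move=> /U_mu_nested[a' a'0 Aa'] /U_mu_nested[b' b'0 Bb'].
have c0 : 0 < Num.min a' b' by rewrite lt_min a'0.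
exists (U_mu f I (Num.min a' b')); split.
- by exists f, (Num.min a' b').
- exact: U_mu_refl.
- by move=> g Ug; split; [apply: Aa' Ug|apply: Bb' Ug]; rewrite ge_min lexx ?orbT.
Qed.

Lemma m_mu_refl f (u : M) : positive_unit u -> m_mu f I u f.
Proof.
move=> u0; split; first by rewrite subrr; exact: ideal0.
exists set0; first exact: null0.
by move=> x _; rewrite subrr normr0; exact: u0.
Qed.

Lemma m_mu_nested f g (u : M) : m_mu f I u g ->
  exists2 v, positive_unit v &
    forall w : M, (forall x, w x <= v x) -> m_mu g I w `<=` m_mu f I u.
Proof.
move=> [Igf [E nE fg]].
have mh : measurable_fun [set: T] (fun x => u x - `|f x - g x|).
  apply: measurable_funB => //; apply: measurableT_comp => //.
  exact: measurable_funB.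
pose k : T -> R := (fun x => u x - `|f x - g x|) \_ (~` E) \+ \1_E.
have mk : measurable_fun [set: T] k.
  apply: measurable_funD; last by apply: measurable_indic; exact: nE.1.
  apply/(measurable_restrictT _ _).1; first by apply: measurableC; exact: nE.1.
  exact: measurable_funTS.
pose kk := isMeasurableFun.Build _ _ _ _ k mk.
pose v : M := HB.pack k kk.
have vE x : v x = if x \in E then 1 else u x - `|f x - g x|.
  rewrite -[v x]/(((fun x => u x - `|f x - g x|) \_ (~` E)) x + \1_E x).
  rewrite patchE indicE in_setC.
  by case: (x \in E); rewrite /= ?add0r ?addr0.
exists v.
  move=> x; rewrite vE; case: ifPn => // /negP xE; rewrite subr_gt0.
  by apply: fg => Ex; apply: xE; rewrite inE.
move=> w wv h [Ihg [F nF gh]].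
split; first exact: ideal_trans Igf Ihg.
exists (E `|` F); first exact: nullU.
move=> x /not_orP[Ex Fx]; rewrite (le_lt_trans (ler_distD (g x) _ _))//.
rewrite -ltrBrDl (lt_le_trans (gh x Fx))// (le_trans (wv x))// vE.
by case: ifPn => //; rewrite inE.
Qed.

Lemma m_base_cover : \bigcup_(B in m_base I) B = [set: M].
Proof.
apply/seteqP; split => // f _; exists (m_mu f I 1).
  by exists f, 1; split => // x; rewrite mfun1 ltr01.
by apply: m_mu_refl => x; rewrite mfun1 ltr01.
Qed.

Lemma m_base_join (A B : set M) f : m_base I A -> m_base I B -> A f -> B f ->
  exists C, [/\ m_base I C, C f & C `<=` A `&` B].
Proof.
move=> [fA [a [a0 ->]]] [fB [b [b0 ->]]].
move=> /m_mu_nested[a' a'0 Aa'] /m_mu_nested[b' b'0 Bb'].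
have c0 : positive_unit (min_mfun a' b').
  by move=> x; rewrite /= lt_min a'0 b'0.
exists (m_mu f I (min_mfun a' b')); split.
- by exists f, (min_mfun a' b').
- exact: m_mu_refl.
- move=> g Ug; split; [apply: Aa' Ug|apply: Bb' Ug] => x;
    by rewrite /= ge_min lexx ?orbT.
Qed.

HB.instance Definition _ := Choice.on (U_space mu hI).
HB.instance Definition _ := Choice.on (m_space mu hI).

HB.instance Definition _ := isBaseTopological.Build (U_space mu hI)
  (b := id) U_base_cover U_base_join.
HB.instance Definition _ := isBaseTopological.Build (m_space mu hI)
  (b := id) m_base_cover m_base_join.

Definition U_topology : set (set M) := @open (U_space mu hI).
Definition m_topology : set (set M) := @open (m_space mu hI).

End measurable_function_topologies.

(* Main.v *)
From HB Require Import structures.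
Require Import Defs.
From mathcomp Require Import all_boot all_order all_algebra.
From mathcomp Require Import all_classical all_reals all_analysis measurable_realfun.

Import Order.TTheory GRing.Theory Num.Theory.
Import numFieldNormedType.Exports.

Local Open Scope classical_set_scope.
Local Open Scope ring_scope.

(** If 1/u is bounded by C almost everywhere off the common zeros of I, then
    U_mu(g, I, 1/C) is contained in m_mu(g, I, u), because h - g in I vanishes
    at these common zeros. Conversely, if U_mu(0, I, e) is contained in
    m_mu(0, I, 1/(1+|f|)), then testing on the functions (e/2) 1_{s <> 0}, which
    lie in I for s in I, bounds |f| by 2/e almost everywhere on {s <> 0}; when
    s ranges over countably many generators these sets cover the complement of
    the common zeros, and the exceptional null sets can be united. *)

(** Inversion is continuous on the open set of nonzero reals, and on the measurable singleton of 0
    any function is measurable. *)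
Lemma measurable_inv (R : realType) :
  measurable_fun [set: R] (@GRing.inv R : R -> R).
Proof.
rewrite -(setvU [set (0 : R)]); apply/measurable_funU => //.
  exact: measurableC.
split; last exact: measurable_fun_set1.
apply: open_continuous_measurable_fun.
  by apply: closed_openC; exact: closed_eq.
by move=> x; rewrite inE /= => /eqP x0; exact: inv_continuous.
Qed.

Section mfun_constructions.
Context d (T : measurableType d) (R : realType).
Implicit Types f : {mfun T >-> R}.

Lemma measurable_mfun (h : T -> R) :
  measurable_fun [set: T] h -> exists g : {mfun T >-> R}, g =1 h.
Proof.
move=> mh; pose hh := isMeasurableFun.Build _ _ _ _ h mh.
by pose g : {mfun T >-> R} := HB.pack h hh; exists g.
Qed.

Lemma mfun_inv f : exists g : {mfun T >-> R}, forall x, g x = (f x)^-1.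
Proof.
apply: measurable_mfun.
exact: (measurableT_comp (measurable_inv R) (measurable_funPT f)).
Qed.

Lemma mfun_norm f : exists g : {mfun T >-> R}, forall x, g x = `|f x|.
Proof. by apply: measurable_mfun; exact: measurableT_comp. Qed.

End mfun_constructions.

Section topologies.
Context d (T : measurableType d) (R : realType).
Context (mu : {measure set T -> \bar R}) (I : set {mfun T >-> R}).
Context (hI : is_ideal I).
Local Notation M := {mfun T >-> R}.

(** Passes from arbitrary basic sets to those centred at the given point: by nestedness, a basic set
    containing [g] contains one centred at [g]. *)
Lemma U_topologyP (O : set M) : U_topology mu hI O <->
  forall g, O g -> exists2 e, 0 < e & U_mu mu g I e `<=` O.
Proof.
split=> [[D DU <-] g [B DB Bg]|H].
  have [f [e [e0 Be]]] := DU _ DB; move: (Bg); rewrite /= Be.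
  move=> /(U_mu_nested hI)[e' e'0 /(_ e' (lexx _)) sub].
  by exists e' => // h /sub Uh; exists B => //; rewrite /= Be.
exists [set B | U_base mu I B /\ B `<=` O]; first by move=> B [].
apply/seteqP; split=> [g [B [_ BO] /BO]//|g Og].
have [e e0 UO] := H _ Og.
exists (U_mu mu g I e); last exact: U_mu_refl.
by split=> //; exists g, e.
Qed.

Lemma m_topologyP (O : set M) : m_topology mu hI O <->
  forall g, O g -> exists2 u, positive_unit u & m_mu mu g I u `<=` O.
Proof.
split=> [[D DU <-] g [B DB Bg]|H].
  have [f [u [u0 Bu]]] := DU _ DB; move: (Bg); rewrite /= Bu.
  move=> /(m_mu_nested hI)[v v0 /(_ v (fun=> lexx _)) sub].
  by exists v => // h /sub mh; exists B => //; rewrite /= Bu.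
exists [set B | m_base mu I B /\ B `<=` O]; first by move=> B [].
apply/seteqP; split=> [g [B [_ BO] /BO]//|g Og].
have [u u0 mO] := H _ Og.
exists (m_mu mu g I u); last exact: m_mu_refl.
by split=> //; exists g, u.
Qed.

Lemma U_topology_sub_m : U_topology mu hI `<=` m_topology mu hI.
Proof.
move=> O /U_topologyP UO; apply/m_topologyP => g /UO[e e0 eO].
(* A pointwise strict bound survives the supremum only as a weak one; halving [e] restores
   strictness. *)
exists (cst (e / 2) : M) => [x|h [Ih [E nE hE]]]; first by rewrite /= divr_gt0.
apply: eO; split=> //; exists E => //; apply/sup_dist_ltP; exists (e / 2).
  by rewrite divr_ge0 ?ltW// gtr_pMr// invf_lt1 ?ltr1n.
by move=> x /hE /ltW.
Qed.

Local Notation Y := (~` \bigcap_(Z in zero_sets I) Z).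

Lemma m_topology_sub_U : mu_bounded mu Y ->
  m_topology mu hI `<=` U_topology mu hI.
Proof.
move=> bY O /m_topologyP mO; apply/U_topologyP => g /mO[u u0 uO].
have [v vE] := mfun_inv _ _ _ u.
have [E nE /pinfty_ex_gt0[C C0 vC]] := bY v.
exists C^-1; first by rewrite invr_gt0.
move=> h [Ih [F nF /sup_dist_ltP[c /andP[c0 cC] hc]]].
apply: uO; split=> //; exists (E `|` F); first exact: nullU.
move=> x /not_orP[Ex Fx].
have [Yx|/contrapT Zx] := pselect (Y x).
  apply: le_lt_trans (hc x Fx) _; apply: lt_le_trans cC _.
  have := vC x (conj Yx Ex); rewrite /= vE gtr0_norm ?invr_gt0 ?u0// => uC.
  by rewrite -[leRHS]invrK lef_pV2// posrE invr_gt0.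
have hg0 : h x - g x = 0 := Zx _ (ex_intro2 _ _ _ Ih erefl).
by rewrite distrC hg0 normr0.
Qed.

(* [s / s] is the indicator of [s <> 0], as [0^-1 = 0]. *)
Lemma ideal_indic s (c : R) : I s ->
  exists2 g : M, I g & forall x, g x = if s x == 0 then 0 else c.
Proof.
move=> Is; have [t tE] := mfun_inv _ _ _ s.
exists ((cst c : M) * t * s); first exact: (idealMl hI).
move=> x; rewrite -[LHS]/(c * t x * s x) tE.
case: eqVneq => [->|s0]; first by rewrite mulr0.
by rewrite mulfVK.
Qed.

(** The bound [C] is uniform in [s]; only the null set varies with [s], and countably many null sets
    have a negligible union. *)
Lemma mu_bounded_cover (S : set M) (A : set T) : countable S ->
  (forall x, A x -> exists2 s, S s & s x != 0) ->
  (forall f : M, exists C : R, forall s, S s ->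
     exists2 E, null mu E & forall x, s x != 0 -> ~ E x -> `|f x| <= C) ->
  mu_bounded mu A.
Proof.
(* Either [S] is empty, and then so is [A], or [e] enumerates [S] by the naturals. *)
move=> /pfcard_geP[->|[e]] covA bS f.
  exists set0; first exact: null0.
  by exists 0; split=> // b b0 x [/covA[]].
have [C hC] := bS f.
have /choice[E hE] : forall n, exists E, null mu E /\
    forall x, e n x != 0 -> ~ E x -> `|f x| <= C.
  move=> n; have [E nE fE] := hC (e n) (funS n Logic.I).
  by exists E.
have [N [mN N0 EN]] : mu.-negligible (\bigcup_n E n).
  by apply: negligible_bigcup => n; have [[mE E0] _] := hE n; exact/negligibleP.
exists N; first by split.
exists C; split=> [|b /ltW Cb x [/covA[s Ss sx0] Nx]]; first exact: num_real.
apply: le_trans Cb.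
have [n _ nE] := @surj _ _ _ _ e s Ss.
have [_] := hE n; apply; first by rewrite nE.
by move=> Enx; apply: Nx; apply: EN; exists n.
Qed.

(** The functions vanishing at [x] form an ideal; if it contained all generators it would contain
    [I], making [x] a common zero. *)
Lemma generators_cover (S : set M) : I = ideal_generated S ->
  forall x, Y x -> exists2 s, S s & s x != 0.
Proof.
move=> IS x Yx; apply: contrapT => noS; apply: Yx => _ [f If <-].
rewrite IS in If.
apply: (If [set g : M | g x = 0]); split.
  split=> [//|a b /= a0 b0|a b /= b0].
    by rewrite -[LHS]/(a x + b x) a0 b0 addr0.
  by rewrite -[LHS]/(a x * b x) b0 mulr0.
move=> s Ss /=; apply/eqP; apply: contrapT => /negP sx.
by apply: noS; exists s.
Qed.

(** [C] can precede [s] because the radius [e] comes from a neighbourhood of 0 that depends on [f]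
    alone. *)
Lemma m_sub_U_bound : m_topology mu hI `<=` U_topology mu hI ->
  forall f : M, exists C : R, forall s, I s ->
    exists2 E, null mu E & forall x, s x != 0 -> ~ E x -> `|f x| <= C.
Proof.
move=> mU f; have [nf nfE] := mfun_norm _ _ _ f.
(* Adding 1 makes the denominator positive everywhere, so [u] is a positive unit. *)
have [u uE] := mfun_inv _ _ _ (1 + nf).
have {}uE x : u x = (1 + `|f x|)^-1 by rewrite uE -nfE.
have u0 : positive_unit u by move=> x; rewrite uE invr_gt0 ltr_pwDl.
have /mU/U_topologyP/(_ 0 (m_mu_refl mu hI 0 u0))[e e0 Usub] :
    m_topology mu hI (m_mu mu 0 I u).
  apply/m_topologyP => g /(m_mu_nested hI)[v v0 /(_ v (fun=> lexx _)) sub].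
  by exists v.
have e20 : 0 < e / 2 by rewrite divr_gt0.
exists (e / 2)^-1 => s Is.
have [g Ig gE] := ideal_indic s (e / 2) Is.
have /Usub[_ [E nE gu]] : U_mu mu 0 I e g.
  split; first by rewrite subr0.
  exists set0; first exact: null0.
  apply/sup_dist_ltP; exists (e / 2).
    by rewrite divr_ge0 ?ltW// gtr_pMr// invf_lt1 ?ltr1n.
  move=> x _; rewrite /= sub0r normrN gE; case: ifP => _.
    by rewrite normr0 ltW.
  by rewrite gtr0_norm.
exists E => // x sx0 /gu.
rewrite /= sub0r normrN gE (negbTE sx0) gtr0_norm// uE => eu.
(* Here [eu] reads e/2 < 1/(1+|f x|); taking inverses bounds 1+|f x|. *)
apply: (@le_trans _ _ (1 + `|f x|)); first by rewrite lerDr.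
by rewrite -[leLHS]invrK lef_pV2 ?posrE ?invr_gt0 ?ltr_pwDl// ltW.
Qed.

End topologies.

Theorem theorem2p7 (d : measure_display) (T : measurableType d) (R : realType)
    (mu : {measure set T -> \bar R}) (I : set {mfun T >-> R})
    (hI : is_ideal I) :
  (mu_bounded mu (~` \bigcap_(Z in zero_sets I) Z) ->
    U_topology mu hI = m_topology mu hI) /\
  (countably_generated I ->
    U_topology mu hI = m_topology mu hI ->
    mu_bounded mu (~` \bigcap_(Z in zero_sets I) Z)).
Proof.
split=> [bY|[S cS IS] UmE].
  apply/seteqP; split; first exact: U_topology_sub_m.
  exact: m_topology_sub_U.
apply: (mu_bounded_cover _ _ _ _ _ _ cS); first exact: generators_cover.
have mU : m_topology mu hI `<=` U_topology mu hI by rewrite UmE.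
move=> f; have [C hC] := m_sub_U_bound _ _ _ _ _ hI mU f.
exists C => s Ss; apply: hC.
by rewrite IS; exact: sub_gen_smallest.
Qed.
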